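(* For $3\le D\le 20000$ there is no graph of degree $9$, diameter $D$ and cyclic defect. Furthermore, for odd $g$ with $7\le g\le 40001$ there is no graph of degree $9$, girth $g$ and cyclic excess.
   Context: For an integer $d\ge 1$ define polynomials $G_{d,m}(x)$ by $G_{d,0}(x)=1$, $G_{d,1}(x)=x+1$, and $G_{d,m+1}(x)=xG_{d,m}(x)-(d-1)G_{d,m-1}(x)$ for $m\ge1$. Let $J_n$ be the $n\times n$ all-ones matrix. For a graph on $n\ge3$ vertices, a cycle matrix is the adjacency matrix $B$ of an $n$-cycle on the same vertex set (i.e., for some ordering $v_1,\dots,v_n$ of the vertices, $B_{ij}=1$ iff $v_i,v_j$ are cyclically consecutive, and $0$ otherwise); this cycle need not consist of edges of the graph. A graph $\Gamma$ of order $n$ with adjacency matrix $A$ is a graph of degree $d$, diameter $D$ and cyclic defect if $\Gamma$ is $d$-regular with $d\ge3$, has diameter $D\ge2$, and $G_{d,D}(A)=J_n+B$ for some cycle matrix $B$. It is a graph of degree $d$, girth $g$ and cyclic excess if $\Gamma$ is $d$-regular with $d\ge3$, has odd girth $g\ge5$, and $G_{d,\lfloor g/2\rfloor}(A)=J_n-B$ for some cycle matrix $B$. *)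

(* Defs.v *)
From mathcomp Require Import all_boot all_order all_algebra all_fingroup.

Set Implicit Arguments.
Unset Strict Implicit.
Unset Printing Implicit Defensive.

Import GRing.Theory.
Local Open Scope ring_scope.

(* The pair (G_{d,m}, G_{d,m+1}). *)
Fixpoint Gpair (d m : nat) : {poly int} * {poly int} :=
  if m is m'.+1 then
    let: (p, q) := Gpair d m' in (q, 'X * q - (d%:R - 1)%:P * p)
  else (1, 'X + 1).

Definition Gpoly (d m : nat) : {poly int} := (Gpair d m).1.

Lemma Gpoly0 d : Gpoly d 0 = 1.
Proof. by []. Qed.

Lemma Gpoly1 d : Gpoly d 1 = 'X + 1.
Proof. by []. Qed.

Lemma GpolyS d m :
  Gpoly d m.+2 = 'X * Gpoly d m.+1 - (d%:R - 1)%:P * Gpoly d m.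
Proof. by rewrite /Gpoly /=; case: (Gpair d m). Qed.

(* Evaluation of a polynomial at a square matrix of arbitrary size: horner_mx
   is only available for sizes of the form n.+1, where the two agree. *)
Definition eval_mx (n : nat) (p : {poly int}) (A : 'M[int]_n) : 'M[int]_n :=
  \sum_(i < size p) p`_i *: A ^+ i.

Lemma eval_mxE (n : nat) (p : {poly int}) (A : 'M[int]_n.+1) :
  eval_mx p A = horner_mx A p.
Proof.
rewrite -[in RHS](coefK p) poly_def raddf_sum; apply: eq_bigr => i _ /=.
by rewrite linearZ /= rmorphXn /= horner_mx_X.
Qed.

Definition simple_graph (T : finType) (e : rel T) : Prop :=
  symmetric e /\ irreflexive e.

Definition regular (T : finType) (e : rel T) (d : nat) : Prop :=
  forall x : T, #|e x| = d.

Definition is_dist (T : finType) (e : rel T) (x y : T) (k : nat) : Prop :=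
  (exists p : seq T, [/\ path e x p, last x p = y & size p = k]) /\
  (forall p : seq T, path e x p -> last x p = y -> (k <= size p)%N).

(* In particular the graph is connected and nonempty. *)
Definition has_diameter (T : finType) (e : rel T) (D : nat) : Prop :=
  (forall x y : T, exists2 k : nat, is_dist e x y k & (k <= D)%N) /\
  (exists x y : T, is_dist e x y D).

Definition graph_cycle (T : finType) (e : rel T) (c : seq T) : Prop :=
  (3 <= size c)%N /\ ucycle e c.

Definition has_girth (T : finType) (e : rel T) (g : nat) : Prop :=
  (exists c : seq T, graph_cycle e c /\ size c = g) /\
  (forall c : seq T, graph_cycle e c -> (g <= size c)%N).

(* Vertices are indexed by their rank in the enumeration of T. *)
Definition adj_mx (T : finType) (e : rel T) : 'M[int]_#|T| :=
  \matrix_(i, j) (e (enum_val i) (enum_val j))%:R.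

(* The vertex ordering v_1, ..., v_n is the permutation v of the indices;
   ordS is the cyclic successor on 'I_n. *)
Definition cycle_mx (n : nat) (B : 'M[int]_n) : Prop :=
  (3 <= n)%N /\
  exists v : 'S_n, forall a b : 'I_n,
    B (v a) (v b) = ((b == ordS a) || (a == ordS b))%:R.

Definition cyclic_defect (T : finType) (e : rel T) (d D : nat) : Prop :=
  simple_graph e /\ regular e d /\ (3 <= d)%N /\
  has_diameter e D /\ (2 <= D)%N /\
  exists B : 'M[int]_#|T|,
    cycle_mx B /\ eval_mx (Gpoly d D) (adj_mx e) = const_mx 1 + B.

Definition cyclic_excess (T : finType) (e : rel T) (d g : nat) : Prop :=
  simple_graph e /\ regular e d /\ (3 <= d)%N /\
  has_girth e g /\ odd g /\ (5 <= g)%N /\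
  exists B : 'M[int]_#|T|,
    cycle_mx B /\ eval_mx (Gpoly d g./2) (adj_mx e) = const_mx 1 - B.

(* Main.v *)
(* The adjacency matrix A commutes with J, hence with the cycle matrix B, so it
   acts on ker B.  Since G_m(9) = 2 mod 8 for m >= 1, the order n = G_m(9) -+ 2
   is divisible by 4, and ker B is then spanned by the two vectors that read
   (1, 0, -1, 0, ...) and (0, 1, 0, -1, ...) along the cycle.  In this basis A is
   a symmetric integer matrix M of size 2 with G_m(M) = 0 and absolute row sums
   at most 9.
   As G_m(-9) = (-8)^m, we can write G_m(X) = (-8)^m + (X + 9) Q(X), where
   Q = X^(m-1) mod 2.  Hence det (M + 9) divides a power of 2, and being at most
   324 < 8^m it is a proper divisor of 8^m; this forces Q(M) = 0 mod 2, so M is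
   nilpotent mod 2 and det (M + 9) is odd, i.e. equal to 1.  The bounds on the
   entries leave only M = -8, which is excluded because (-1)^m G_m(-8) grows. *)
Require Import Defs.
From mathcomp Require Import all_boot all_order all_algebra all_fingroup.
From mathcomp Require Import zify ring.

Set Implicit Arguments.
Unset Strict Implicit.
Unset Printing Implicit Defensive.

Section CyclicDefectOrExcess.
Import Order.TTheory GRing.Theory Num.Theory.
Local Open Scope ring_scope.

(** * The polynomials [Gpoly 9 m]: values at 9 and -8, division by X + 9 *)

Lemma Gpoly9S (m : nat) :
  Gpoly 9 m.+2 = 'X * Gpoly 9 m.+1 - 8%:P * Gpoly 9 m.
Proof. by rewrite GpolyS. Qed.

Lemma horner_Gpoly9S (x : int) (m : nat) :
  (Gpoly 9 m.+2).[x] = x * (Gpoly 9 m.+1).[x] - 8 * (Gpoly 9 m).[x].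
Proof. by rewrite Gpoly9S hornerD hornerN !hornerM hornerX hornerC. Qed.

(** Modulo 8 the recurrence at 9 repeats the previous value, starting from 10. *)
Lemma Gpoly9_horner9 (m : nat) : exists k : int, (Gpoly 9 m.+1).[9] = 8 * k + 2.
Proof.
elim: m => [|m [k Hk]]; first by exists 1; rewrite Gpoly1 !hornerE.
exists (9 * k + 2 - (Gpoly 9 m).[9]).
by rewrite horner_Gpoly9S Hk; ring.
Qed.

(** The values a(m) = (-1)^m G_m(-8) satisfy a(m+2) = 8 a(m+1) - 8 a(m), so 2 a(m) <= a(m+1) gives
    a(m+2) >= 4 a(m+1): they stay positive and at least double. *)
Lemma Gpoly9_hornerN8 (m : nat) : (Gpoly 9 m).[-8] != 0.
Proof.
suff [+ _]: 0 < (-1) ^+ m * (Gpoly 9 m).[-8] /\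
  2 * ((-1) ^+ m * (Gpoly 9 m).[-8])
    <= (-1) ^+ m.+1 * (Gpoly 9 m.+1).[-8].
  by apply: contraTneq => ->; rewrite mulr0 ltxx.
elim: m => [|m [H0 H1]]; first by rewrite Gpoly0 Gpoly1 !hornerE.
split; first by lia.
by move: H0 H1; rewrite horner_Gpoly9S !exprS; lia.
Qed.

Lemma Gpoly9_divXD9 (m : nat) : exists r : {poly int},
  Gpoly 9 m.+1 = ((- 8) ^+ m.+1)%:P + ('X + 9%:P) * ('X^m + 2 *: r).
Proof.
suff [r [s [Hr Hs]]]: exists r s : {poly int},
   Gpoly 9 m.+1 = (- 8%:R) ^+ m.+1 + ('X + 9%:R) * ('X^m + 2%:R * r) /\
   Gpoly 9 m.+2 = (- 8%:R) ^+ m.+2 + ('X + 9%:R) * ('X^(m.+1) + 2%:R * s).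
  by exists r; rewrite Hr -mul_polyC polyC_exp polyCN !polyC_natr.
elim: m => [|m [r [s [Hr Hs]]]].
  by exists 0, (- 4%:R); rewrite Gpoly9S Gpoly1 Gpoly0 polyC_natr; split; ring.
(* The quotients by X + 9 satisfy Q'' = X Q' - 8 Q + (-8)^(m+2), the last term coming from the
   remainders. The witness is half of Q'' - X^(m+2). *)
exists s, ('X * s - 4%:R * ('X^m + 2%:R * r) - 4%:R * (- 8%:R) ^+ m.+1).
by split=> //; rewrite Gpoly9S Hs Hr polyC_natr !exprS; ring.
Qed.

(** * Matrices of size 2, and polynomials in a matrix *)

Lemma ord2E (P : 'I_2 -> Prop) : P 0 -> P 1 -> forall i, P i.
Proof.
move=> P0 P1 [[|[|i]] hi] //.
- by have -> : Ordinal hi = 0 by exact/val_inj.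
- by have -> : Ordinal hi = 1 by exact/val_inj.
Qed.

Lemma sum_ord2 (V : nmodType) (F : 'I_2 -> V) : \sum_i F i = F 0 + F 1.
Proof.
by rewrite !big_ord_recl big_ord0 addr0; congr (_ + F _); exact/val_inj.
Qed.

Lemma det_mx2 (R : comNzRingType) (M : 'M[R]_2) :
  \det M = M 0 0 * M 1 1 - M 0 1 * M 1 0.
Proof.
rewrite (expand_det_row _ 0) sum_ord2 /cofactor !det_mx11 !mxE /=.
have -> : lift 0 0 = 1 :> 'I_2 by exact/val_inj.
have -> : lift 1 0 = 0 :> 'I_2 by exact/val_inj.
by rewrite expr0 expr1; ring.
Qed.

Lemma mxtrace2 (R : comNzRingType) (M : 'M[R]_2) : \tr M = M 0 0 + M 1 1.
Proof. exact: sum_ord2. Qed.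

Lemma Cayley_Hamilton2 (R : comNzRingType) (M : 'M[R]_2) :
  M * M = \tr M *: M - (\det M)%:M.
Proof.
apply/matrixP; apply: ord2E; apply: ord2E;
  by rewrite !mxE sum_ord2 mxtrace2 det_mx2 /=; ring.
Qed.

(** Modulo 2 the determinant vanishes by multiplicativity. Were the trace odd, Cayley-Hamilton would
    make M idempotent mod 2, hence equal to its power, hence zero, with even trace. *)
Lemma nilpotent_mod2 (M S : 'M[int]_2) (m : nat) :
  M ^+ m.+1 = 2 *: S -> (2 %| \tr M)%Z /\ (2 %| \det M)%Z.
Proof.
move=> HM; have det_even : (2 %| \det M)%Z.
  have: (2 %| \det (M ^+ m.+1))%Z by rewrite HM detZ exprS -mulrA dvdz_mulr.
  have -> : \det (M ^+ m.+1) = \det M ^+ m.+1.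
    elim: m {HM} => // m IH.
    by rewrite exprS -[_ * _]/(_ *m _) det_mulmx IH -exprS.
  by rewrite dvdzE abszX Euclid_dvdX // => /andP[].
split=> //; have /dvdzP[d Hd] := det_even.
apply: contraT => tr_odd; have [t Ht] : exists t, \tr M = 2 * t + 1.
  by exists (\tr M %/ 2)%Z; move: tr_odd; lia.
have [R HR] : exists R : 'M[int]_2, M ^+ m.+1 = M + 2 *: R.
  elim: m {HM} => [|m [R HR]]; first by exists 0; rewrite scaler0 addr0.
  exists (t *: M - d%:M + M * R); rewrite exprS HR mulrDr Cayley_Hamilton2 Ht Hd.
  rewrite -scalerAr !scalerDr addrA; congr (_ + _).
  by apply/matrixP=> i j; rewrite !mxE; ring.
suff: (2 %| \tr M)%Z by rewrite (negPf tr_odd).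
have -> : M = 2 *: (S - R) by rewrite scalerBr -HM HR addrK.
by rewrite mxtraceZ dvdz_mulr.
Qed.

Lemma det_addr9_odd (a b c t d x : int) :
  a + c = t * 2 -> a * c - b * b = d * 2 ->
  (a + 9) * (c + 9) - b * b != 2 * x.
Proof. by move=> Ht Hd; apply/eqP; lia. Qed.

(** Both a + 9 and c + 9 are at least |b| and have the same parity. If distinct they differ by at
    least 2, and the determinant is 0 or at least 2. If equal, a difference of two squares is 1, so
    b = 0 and a + 9 = 1. *)
Lemma det_addr9_eq1 (a b c t : int) :
  a + c = t * 2 -> (a + 9) * (c + 9) - b * b = 1 ->
  `|a| + `|b| <= 9 -> `|b| + `|c| <= 9 -> [/\ a = -8, c = -8 & b = 0].
Proof.
move=> Ht Hd h1 h2.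
have [ac | ac] := eqVneq a c; last by exfalso; nia.
have b0 : b = 0 by subst c; nia.
by split; nia.
Qed.

Lemma Gpoly9_mx2_neq0 (M : 'M[int]_2) (m : nat) :
  M 1 0 = M 0 1 ->
  `|M 0 0| + `|M 0 1| <= 9 -> `|M 0 1| + `|M 1 1| <= 9 ->
  horner_mx M (Gpoly 9 m.+3) != 0.
Proof.
move=> Msym le0 le1; apply/negP=> /eqP GM0.
pose N := M + 9%:M.
have detN : \det N = (M 0 0 + 9) * (M 1 1 + 9) - M 0 1 ^+ 2.
  by rewrite det_mx2 !mxE Msym /=; ring.
have [r Hr] := Gpoly9_divXD9 m.+2.
pose Q := M ^+ m.+2 + 2 *: horner_mx M r.
have NQ : N *m Q = (- (- 8) ^+ m.+3)%:M.
  apply/eqP; rewrite -subr_eq0 -raddfN opprK -GM0 Hr; apply/eqP.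
  have hD p q : horner_mx M (p + q) = horner_mx M p + horner_mx M q := rmorphD _ _ _.
  have hM p q : horner_mx M (p * q) = horner_mx M p * horner_mx M q := rmorphM _ _ _.
  have hX k : horner_mx M 'X^k = M ^+ k.
    by rewrite rmorphXn; congr (_ ^+ k); exact: horner_mx_X.
  by rewrite hD hM !hD hX !horner_mx_C horner_mxZ horner_mx_X addrC.
(* The adjugate shows that Q is [\adj N] scaled by -(-8)^(m+3) / det N. *)
have QE : \det N *: Q = (- (- 8) ^+ m.+3) *: \adj N.
  by rewrite -mul_scalar_mx -mul_adj_mx -mulmxA NQ mul_mx_scalar.
have detN_dvd : (\det N %| 64 ^+ m.+3)%Z.
  apply/dvdzP; exists (\det Q).
  have := congr1 determinant NQ; rewrite det_mulmx det_scalar mulrC => ->.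
  by rewrite sqrrN -exprM mulnC exprM.
(* The row bounds put both diagonal entries of N between [|M 0 1|] and 18, and 18^2 = 324 < 2^9. *)
have detN_le : `|\det N| <= 324 by rewrite detN; nia.
have detN_ge0 : 0 <= \det N by rewrite detN; nia.
have [j [lej detNj]] : exists j : nat, (j <= 8)%N /\ \det N = 2 ^+ j.
  move: detN_dvd; rewrite dvdzE abszX (_ : absz 64 = 2 ^ 6)%N // -expnM.
  case/dvdn_pfactor => // j _ detNj; exists j.
  have detNE : \det N = 2 ^+ j by rewrite -(gez0_abs detN_ge0) detNj -natrX natz.
  split=> //; rewrite leqNgt; apply/negP=> lt8j.
  have : (2 ^ 9 <= 2 ^ j)%N by rewrite leq_exp2l.
  by move: detN_le detN_ge0; rewrite -detNj; lia.
(* Since j <= 8 < 9 <= 3(m + 3), the quotient by 2^j is still even; the index being at least 3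
   ensures this. *)
have [z Hz] : exists z : int, - (- 8) ^+ m.+3 = 2 ^+ j * (2 * z).
  exists (- (- 1) ^+ m.+3 * 2 ^+ (3 * m.+3 - j.+1)).
  rewrite mulrCA mulrA mulrCA -exprS -exprD -[in LHS](mulN1r 8) exprMn.
  by rewrite subnKC ?exprM ?mulNr //; lia.
have [tr_even det_even] : (2 %| \tr M)%Z /\ (2 %| \det M)%Z.
  apply: (@nilpotent_mod2 _ (z *: \adj N - horner_mx M r) m.+1).
  have : Q = (2 * z) *: \adj N.
    have nz2j : (2 ^+ j : int) != 0 by rewrite expf_neq0.
    by apply: (scalemx_inj nz2j); rewrite scalerA -Hz -detNj.
  by rewrite scalerBr scalerA => <-; rewrite addrK.
have detN1 : \det N = 1.
  case: j {Hz lej} detNj => [|j detNj]; first by rewrite expr0.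
  move: tr_even det_even detNj; rewrite detN expr2 exprS det_mx2 mxtrace2 Msym.
  case/dvdzP=> t Ht /dvdzP[d Hd] H.
  by have /eqP[] := det_addr9_odd (2 ^+ j) Ht Hd.
have [M00 M11 M01] : [/\ M 0 0 = -8, M 1 1 = -8 & M 0 1 = 0].
  have /dvdzP[t Ht] := tr_even; rewrite mxtrace2 in Ht.
  by move: detN1; rewrite detN expr2 => H; exact: det_addr9_eq1 Ht H le0 le1.
have ME : M = diag_mx (const_mx (- 8)).
  by apply/matrixP; apply: ord2E; apply: ord2E; rewrite !mxE /= ?M00 ?M11 ?Msym ?M01.
have := Gpoly9_hornerN8 m.+3; case/negP; apply/eqP.
by move: GM0; rewrite ME horner_mx_diag => /matrixP/(_ 0 0); rewrite !mxE.
Qed.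

(** Used with X the all-ones column, where C is the scalar 9, and with X a basis of the kernel of B,
    where C is the restriction of A. *)
Lemma horner_mx_intertwine (R : comNzRingType) (n k : nat) (A : 'M[R]_n.+1)
    (C : 'M[R]_k.+1) (X : 'M[R]_(n.+1, k.+1)) (p : {poly R}) :
  A *m X = X *m C -> horner_mx A p *m X = X *m horner_mx C p.
Proof.
move=> AX; elim/poly_ind: p => [|p c IH]; first by rewrite !rmorph0 mul0mx mulmx0.
rewrite !rmorphD !rmorphM /= !horner_mx_X !horner_mx_C mulmxDl mulmxDr.
congr (_ + _); last by rewrite mul_scalar_mx mul_mx_scalar.
by rewrite -[LHS]mulmxA AX [LHS]mulmxA IH [RHS]mulmxA.
Qed.

(** * The kernel of a cycle matrix *)

Definition quarter (k : nat) : int := (k %% 4 == 0)%N%:R - (k %% 4 == 2)%N%:R.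

Lemma quarterD2 k : quarter (k + 2) = - quarter k.
Proof. by rewrite /quarter; lia. Qed.

Lemma quarterD4 k : quarter (k + 4) = quarter k.
Proof. by rewrite -[4%N]/(2 + 2)%N addnA !quarterD2 opprK. Qed.

Lemma quarter_modn (n k c : nat) : (4 %| n)%N -> quarter (k %% n + c) = quarter (k + c).
Proof. by move=> n4; rewrite /quarter -modnDml modn_dvdm // modnDml. Qed.

Lemma quarter_mul3 k : quarter k * quarter (k + 3) = 0.
Proof. by rewrite /quarter; do !case: eqP => ? //=; lia. Qed.

Lemma quarter_norm_le1 k : `|quarter k| + `|quarter (k + 3)| <= 1.
Proof. by rewrite /quarter; lia. Qed.

Section Matrices.
Variables (n : nat) (v : 'S_n.+1) (B : 'M[int]_n.+1).
Hypothesis n_ge3 : (3 <= n.+1)%N.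
Hypothesis BE : forall a b : 'I_n.+1,
  B (v a) (v b) = ((b == ordS a) || (a == ordS b))%:R.

Lemma cycle_mulmx (k : nat) (X : 'M[int]_(n.+1, k)) a j :
  (B *m X) (v a) j = X (v (ordS a)) j + X (v (ord_pred a)) j.
Proof.
rewrite mxE (reindex_inj (@perm_inj _ v)) /=.
(* With at least three vertices the two neighbours are distinct, so the row of B contributes two
   separate terms. *)
have neq : ord_pred a != ordS a.
  rewrite eq_sym; apply/eqP=> /(congr1 val) /= => /eqP; rewrite addnS /= -addn1 eqn_modDl.
  by rewrite !modn_small //; lia.
rewrite (bigD1 (ordS a)) //= (bigD1 (ord_pred a)) //= big1 ?addr0.
  by rewrite !BE eqxx ord_predK eqxx orbT !mul1r.
move=> b /andP[/negPf b1 b2]; rewrite BE b1 /=.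
have [ab|_] := a =P ordS b; last by rewrite mul0r.
by rewrite ab ordSK eqxx in b2.
Qed.

Hypothesis n4 : (4 %| n.+1)%N.

(** At position k of the cycle the two columns read cos(k pi/2) and sin(k pi/2). The shift 3 stands
    for -1 modulo 4 and stays within [nat]. *)
Definition cycle_ker : 'M[int]_(n.+1, 2) :=
  \matrix_(i, j) quarter ((v^-1)%g i + 3 * j).

Local Notation W := cycle_ker.

Lemma cycle_kerE a j : W (v a) j = quarter (a + 3 * j).
Proof. by rewrite mxE permK. Qed.

Lemma quarter_ordS (a : 'I_n.+1) c : quarter (ordS a + c) = quarter (a + c.+1).
Proof. by rewrite /= quarter_modn // addSnnS. Qed.

Lemma mul_cycle_ker : B *m W = 0.
Proof.
apply/matrixP=> i j; rewrite -(permKV v i) cycle_mulmx !cycle_kerE mxE.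
set a := (v^-1)%g i; rewrite -[in X in quarter (ordS X + _)](ord_predK a).
by rewrite !quarter_ordS -addn2 addnA quarterD2 addNr.
Qed.

Lemma sum_quarter c : \sum_(a < n.+1) quarter (a + c) = 0.
Proof.
(* Two steps along the cycle negate every term, so the sum is its own opposite. *)
have H : \sum_(a < n.+1) quarter (a + c) = - \sum_(a < n.+1) quarter (a + c).
  rewrite {1}(reindex_inj (@ordS_inj _)) {1}(reindex_inj (@ordS_inj _)) -sumrN.
  by apply: eq_bigr => a _; rewrite !quarter_ordS -addn2 addnA quarterD2.
lia.
Qed.

Lemma const_mul_cycle_ker : (const_mx 1 : 'M_n.+1) *m W = 0.
Proof.
apply/matrixP=> i j; rewrite !mxE (reindex_inj (@perm_inj _ v)) /=.
by under eq_bigr => a _ do rewrite mxE mul1r cycle_kerE; exact: sum_quarter.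
Qed.

(** A kernel vector changes sign every two steps, so its values at positions 0 and 1 determine it.
    They serve as coordinates, which are therefore integers. *)
Lemma cycle_ker_span k (X : 'M[int]_(n.+1, k)) :
  B *m X = 0 -> X = W *m \matrix_(p < 2, j < k) X (v (inord p)) j.
Proof.
move=> BX; apply/matrixP=> i j; rewrite -(permKV v i).
set a := (v^-1)%g i; rewrite mxE sum_ord2 !cycle_kerE !mxE /= muln0 addn0 muln1.
suff H m : (m < n)%N ->
    X (v (inord m)) j = quarter m * X (v (inord 0)) j
                        + quarter (m + 3) * X (v (inord 1)) j /\
    X (v (inord m.+1)) j = quarter m.+1 * X (v (inord 0)) j
                           + quarter (m.+1 + 3) * X (v (inord 1)) j.
  have [a0|a0] := posnP a.
    have [] := H 0%N _; first by lia.
    by move=> + _; rewrite -[in v a](inord_val a) a0.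
  have [] := H a.-1 _; first by have := ltn_ord a; lia.
  by rewrite prednK // inord_val.
elim: m => [_|m IH ltm].
  by rewrite /quarter /= !(mul1r, mul0r, subr0, addr0, add0r).
have [H0 H1] := IH (ltnW ltm); split=> //.
have /matrixP/(_ (v (inord m.+1)) j) := BX; rewrite cycle_mulmx mxE.
have -> : ordS (inord m.+1 : 'I_n.+1) = inord m.+2.
  by apply/val_inj; rewrite /= !inordK ?modn_small //; lia.
have -> : ord_pred (inord m.+1 : 'I_n.+1) = inord m.
  apply/val_inj; rewrite /= !inordK ?addSn /=; try lia.
  by rewrite modnDr modn_small; lia.
move/eqP; rewrite addr_eq0 => /eqP ->.
have qS2 k' : quarter k'.+2 = - quarter k' by rewrite -addn2 quarterD2.
by rewrite H0 !addSn !qS2 opprD !mulNr.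
Qed.

(** Reading rows at positions 0 and 1 thus cancels W on the left of a product. *)
Lemma cycle_ker_id (p q : 'I_2) : W (v (inord p)) q = (p == q)%:R.
Proof.
rewrite cycle_kerE inordK; last by have := ltn_ord p; lia.
by move: q; apply: ord2E; move: p; apply: ord2E.
Qed.

(** The columns have disjoint supports and are shifts of each other, hence are orthogonal of equal
    norm. This carries the symmetry of A over to its restriction. *)
Lemma tr_cycle_ker_mul : exists2 s : int, s != 0 & W^T *m W = s%:M.
Proof.
pose s := \sum_(a < n.+1) quarter a ^+ 2; exists s.
  rewrite gt_eqF // /s (bigD1 ord0) //= ltr_pwDl //.
  by apply: sumr_ge0 => a _; exact: sqr_ge0.
apply/matrixP=> p q; rewrite mxE (reindex_inj (@perm_inj _ v)) /=.
under eq_bigr => a _ do rewrite mxE !cycle_kerE.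
move: p q; apply: ord2E; apply: ord2E; rewrite !mxE /= ?mulr1n ?mulr0n.
- by apply: eq_bigr => a _; rewrite muln0 addn0 expr2.
- by apply: big1 => a _; rewrite muln0 addn0 muln1 quarter_mul3.
- by apply: big1 => a _; rewrite muln0 addn0 muln1 mulrC quarter_mul3.
- rewrite (reindex_inj (@ordS_inj _)); apply: eq_bigr => a _.
  by rewrite quarter_ordS muln1 quarterD4 expr2.
Qed.

(** * The adjacency matrix restricted to the kernel *)

Variable A : 'M[int]_n.+1.
Hypothesis A_sym : A^T = A.
Hypothesis A_ge0 : forall i j, 0 <= A i j.
Hypothesis A_sum : forall i, \sum_j A i j = 9.

Lemma comm_const_mx : A *m const_mx 1 = (const_mx 1 : 'M_n.+1) *m A.
Proof.
apply/matrixP=> i j; rewrite !mxE; transitivity (9 : int).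
  by rewrite -[RHS](A_sum i); apply: eq_bigr => k _; rewrite mxE mulr1.
by rewrite -(A_sum j); apply: eq_bigr => k _; rewrite mxE mul1r -{1}A_sym mxE.
Qed.

Hypothesis AB : A *m B = B *m A.

Let M := \matrix_(p < 2, q < 2) (A *m W) (v (inord p)) q.

Lemma adj_mul_cycle_ker : A *m W = W *m M.
Proof. by apply: cycle_ker_span; rewrite mulmxA -AB -mulmxA mul_cycle_ker mulmx0. Qed.

(** A nonzero multiple of M equals [W^T *m A *m W], which is symmetric. *)
Lemma restr_sym : M 1 0 = M 0 1.
Proof.
have [s s0 Hs] := tr_cycle_ker_mul.
have H : s *: M = W^T *m A *m W.
  by rewrite -mulmxA adj_mul_cycle_ker mulmxA Hs mul_scalar_mx.
have: (s *: M)^T = s *: M by rewrite H !trmx_mul A_sym trmxK mulmxA.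
by move=> /matrixP/(_ 0 1); rewrite [LHS]mxE ![(s *: M) _ _]mxE => /(mulfI s0).
Qed.

(** Each row of W has absolute sum at most 1, so a row of [A *m W] is bounded by the corresponding
    row sum of A. *)
Lemma restr_le (p : 'I_2) : `|M p 0| + `|M p 1| <= 9.
Proof.
rewrite [M p 0]mxE [M p 1]mxE !mxE -(A_sum (v (inord p))).
apply: le_trans (lerD (ler_norm_sum _ _ _) (ler_norm_sum _ _ _)) _.
rewrite -big_split /=; apply: ler_sum => i _.
rewrite !normrM (ger0_norm (A_ge0 _ _)) -mulrDr ler_piMr //.
by rewrite -(permKV v i) !cycle_kerE muln0 addn0 muln1 quarter_norm_le1.
Qed.

(** Both J and B kill W, so W p(M) = p(A) W = 0, and W cancels. *)
Lemma restr_horner (eps : int) (p : {poly int}) :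
  horner_mx A p = const_mx 1 + eps *: B -> horner_mx M p = 0.
Proof.
move=> HG; have := horner_mx_intertwine p adj_mul_cycle_ker.
rewrite HG mulmxDl -scalemxAl mul_cycle_ker scaler0 addr0 const_mul_cycle_ker.
move=> /esym WG; apply/matrixP=> i j; rewrite mxE.
move/matrixP: WG => /(_ (v (inord i)) j); rewrite [RHS]mxE mxE (bigD1 i) //=.
rewrite cycle_ker_id eqxx mul1r big1 ?addr0 // => k ki.
by rewrite cycle_ker_id eq_sym (negPf ki) mul0r.
Qed.

End Matrices.

(** * The contradiction for matrices, then for graphs *)

Lemma cycle_polynomial_false (n : nat) (A B : 'M[int]_n) (eps : int) (D : nat) :
  cycle_mx B -> A^T = A -> (forall i j, 0 <= A i j) ->
  (forall i, \sum_j A i j = 9) -> `|eps| = 1 -> (3 <= D)%N ->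
  eval_mx (Gpoly 9 D) A <> const_mx 1 + eps *: B.
Proof.
case: n A B => [|n] A B [] // n_ge3 [v BE] A_sym A_ge0 A_sum eps1.
case: D => [|[|[|m]]] // _; rewrite eval_mxE => GA.
have A1 : A *m const_mx 1 = (const_mx 1 : 'cV_n.+1) *m diag_mx (const_mx 9).
  apply/matrixP=> i j; rewrite !mxE big_ord1 !mxE (ord1 j) eqxx mulr1n mul1r.
  by rewrite -(A_sum i); apply: eq_bigr => k _; rewrite mxE mulr1.
(* On the all-ones column the identity gives G_m(9) = order + 2 eps. As G_m(9) = 2 mod 8 and eps is
   1 or -1, the order is 0 or 4 mod 8. *)
have n4 : (4 %| n.+1)%N.
  have := horner_mx_intertwine (Gpoly 9 m.+3) A1.
  rewrite horner_mx_diag GA mulmxDl -scalemxAl.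
  move=> /matrixP/(_ (v 0) 0).
  rewrite mxE [X in _ + X]mxE (cycle_mulmx n_ge3 BE) !mxE big_ord1 !mxE eqxx mulr1n mul1r.
  under eq_bigr => k _ do rewrite !mxE mulr1.
  rewrite sumr_const card_ord -mulr_natl mulr1.
  by have [k ->] := Gpoly9_horner9 m.+2; move: eps1 => /eqP; lia.
(* Up to the sign eps, B is a polynomial in A minus J, and regularity with symmetry makes J commute
   with A. *)
have AB : A *m B = B *m A.
  have eps0 : eps != 0 by rewrite -normr_eq0 eps1.
  apply: (scalemx_inj eps0); rewrite scalemxAr scalemxAl.
  have -> : eps *: B = horner_mx A (Gpoly 9 m.+3) - const_mx 1.
    by rewrite GA addrC addKr.
  rewrite mulmxBr mulmxBl comm_const_mx //; congr (_ - _).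
  exact: comm_mx_horner.
have := restr_horner n_ge3 BE n4 AB GA; apply/eqP/Gpoly9_mx2_neq0.
- exact: restr_sym.
- exact: restr_le.
- by rewrite -(restr_sym n_ge3 BE n4) //; exact: restr_le.
Qed.

Lemma adj_mx_sum (T : finType) (e : rel T) (d : nat) (i : 'I_#|T|) :
  regular e d -> \sum_j adj_mx e i j = d%:R.
Proof.
move=> /(_ (enum_val i)) <-; rewrite -[#|e _|]sum1_card natr_sum [RHS]big_mkcond /=.
rewrite [RHS](reindex_onto enum_val enum_rank) => [|x _]; last exact: enum_rankK.
apply: eq_big => [j | j _]; first by rewrite /= enum_valK eqxx.
by rewrite mxE -topredE /=; case: (e _ _).
Qed.

Lemma adj_mx_sym (T : finType) (e : rel T) :
  symmetric e -> (adj_mx e)^T = adj_mx e.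
Proof. by move=> e_sym; apply/matrixP=> i j; rewrite !mxE e_sym. Qed.

Lemma adj_mx_ge0 (T : finType) (e : rel T) i j : 0 <= adj_mx e i j.
Proof. by rewrite mxE ler0n. Qed.

End CyclicDefectOrExcess.

Theorem theorem8 :
  (forall D : nat, 3 <= D <= 20000 ->
     ~ exists (T : finType) (e : rel T), cyclic_defect e 9 D) /\
  (forall g : nat, odd g -> 7 <= g <= 40001 ->
     ~ exists (T : finType) (e : rel T), cyclic_excess e 9 g).
Proof.
split=> [D /andP[D_ge3 _] | g g_odd /andP[g_ge7 _]] [T [e]].
- case=> [[e_sym _] [e_reg [_ [_ [_ [B [cycB]]]]]]].
  rewrite -[B in RHS]GRing.scale1r; apply: cycle_polynomial_false => //.
  + exact: adj_mx_sym.
  + exact: adj_mx_ge0.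
  + by move=> i; exact: adj_mx_sum.
- case=> [[e_sym _] [e_reg [_ [_ [_ [_ [B [cycB]]]]]]]].
  rewrite -[(- B)%R]GRing.scaleN1r; apply: cycle_polynomial_false => //.
  + exact: adj_mx_sym.
  + exact: adj_mx_ge0.
  + by move=> i; exact: adj_mx_sum.
  (* Halving 7 <= g gives the required index bound, as [7./2] is 3. *)
  + exact: (half_leq g_ge7).
Qed.
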